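(* Let $m,n\ge 0$ and let $\mu:\mathrm{St}_m\otimes\mathrm{St}_n\to\mathrm{St}_{m+n}$ be the join product on rational Steinberg modules. For ordered bases $v_1,\dots,v_m$ of $\mathbb Q^m$ and $w_1,\dots,w_n$ of $\mathbb Q^n$, $$\mu\bigl([\![v_1,\dots,v_m]\!]\otimes[\![w_1,\dots,w_n]\!]\bigr)=[\![\phi(v_1),\dots,\phi(v_m),\psi(w_1),\dots,\psi(w_n)]\!],$$ where $\phi:\mathbb Q^m\to\mathbb Q^{m+n}$ and $\psi:\mathbb Q^n\to\mathbb Q^{m+n}$ are the embeddings onto the first $m$ and the last $n$ coordinates.
   Context: All chains are normalized rational chains, with differential $\sum_i(-1)^id_i$; $\widetilde C_*(X)=C_*(X)/C_*( * )$ for pointed $X$. For a $\mathbb Q$-vector space $V$ of finite dimension $n$, $\Sigma\mathrm{ST}(V)$ is the pointed simplicial set whose $k$-simplices are flags $V_0\subseteq\cdots\subseteq V_k$ of subspaces of $V$ ($d_i$ deletes $V_i$, $s_i$ repeats $V_i$), with the simplicial subset of flags having $V_0\neq0$ or $V_k\ne V$ collapsed to the basepoint (for $V=0$ a disjoint basepoint is adjoined, so $\Sigma\mathrm{ST}(0)\cong S^0$). It realizes the double unreduced suspension of the Tits building of $V$; its reduced homology is concentrated in degree $n$, and $\mathrm{St}(V)=\widetilde H_n(\Sigma\mathrm{ST}(V);\mathbb Q)$ is the rational Steinberg module, with $\mathrm{St}(0)=\mathbb Q$. Write $\Sigma\mathrm{ST}_n=\Sigma\mathrm{ST}(\mathbb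 Q^n)$, $\mathrm{St}_n=\mathrm{St}(\mathbb Q^n)$. For an ordered basis $v_1,\dots,v_n$ of $V$, the apartment class $[\![v_1,\dots,v_n]\!]$ is the class of $\sum_{\sigma\in\Sigma_n}\operatorname{sgn}(\sigma)\,(0\subset\langle v_{\sigma(1)}\rangle\subset\cdots\subset\langle v_{\sigma(1)},\dots,v_{\sigma(n-1)}\rangle\subset V)$. The Eilenberg–Zilber map $\mathrm{EZ}:\widetilde C_*(X)\otimes\widetilde C_*(Y)\to\widetilde C_*(X\wedge Y)$ is $\mathrm{EZ}(x\otimes y)=\sum_{(a,b)}\operatorname{sgn}(a,b)(s_bx,s_ay)$ for $x\in X_p,y\in Y_q$, the sum over $(p,q)$-shuffles $(a_1<\cdots<a_p,\,b_1<\cdots<b_q)$, i.e. partitions of $\{1,\dots,p+q\}$, with $\operatorname{sgn}(a,b)$ the sign of the permutation $(a_1,\dots,a_p,b_1,\dots,b_q)$, $s_b=s_{b_q-1}\cdots s_{b_1-1}$ and $s_a=s_{a_p-1}\cdots s_{a_1-1}$. The flag-sum map $\theta_{m,n}:\Sigma\mathrm{ST}_m\times\Sigma\mathrm{ST}_n\to\Sigma\mathrm{ST}_{m+n}$, $(V_\bullet,W_\bullet)\mapsto\phi(V_\bullet)+\psi(W_\bullet)$, factors through the smash product $\Sigma\mathrm{ST}_m\wedge\Sigma\mathrm{ST}_n$. The join product $\mu$ is the map induced on $H_{m+n}$ by $(\theta_{m,n})_*\circ\mathrm{EZ}:\widetilde C_*(\Sigma\mathrm{ST}_m)\otimes\widetilde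 C_*(\Sigma\mathrm{ST}_n)\to\widetilde C_*(\Sigma\mathrm{ST}_{m+n})$. *)

(* Defs.v *)
From HB Require Import structures.
From mathcomp Require Import freeg.
From mathcomp Require Import all_boot all_order all_algebra.
From mathcomp Require Import perm zify.
From mathcomp Require Import boolp.

Set Implicit Arguments.
Unset Strict Implicit.
Unset Printing Implicit Defensive.

Import GRing.Theory.
Local Open Scope ring_scope.
Local Open Scope quotient_scope.

(* In the simplicial identities [inord] only changes the ordinal type of an
   index that is already in range. *)
Record sSet := SSet {
  simp :> nat -> choiceType;
  face : forall k, 'I_k.+2 -> simp k.+1 -> simp k;
  degen : forall k, 'I_k.+1 -> simp k -> simp k.+1;
  face_face : forall k (i : 'I_k.+2) (j : 'I_k.+3) (x : simp k.+2),
    (i < j)%N -> face i (face j x) = face (inord j.-1) (face (inord i) x);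
  degen_degen : forall k (i j : 'I_k.+1) (x : simp k),
    (i <= j)%N -> degen (inord i) (degen j x) = degen (inord j.+1) (degen i x);
  face_degen_lt : forall k (i : 'I_k.+3) (j : 'I_k.+2) (x : simp k.+1),
    (i < j)%N -> face i (degen j x) = degen (inord j.-1) (face (inord i) x);
  face_degen_id : forall k (i : 'I_k.+2) (j : 'I_k.+1) (x : simp k),
    (i == j :> nat) || (i == j.+1 :> nat) -> face i (degen j x) = x;
  face_degen_gt : forall k (i : 'I_k.+3) (j : 'I_k.+2) (x : simp k.+1),
    (j.+1 < i)%N -> face i (degen j x) = degen (inord j) (face (inord i.-1) x)
}.

Arguments face {s k} _ _ : simpl never.
Arguments degen {s k} _ _ : simpl never.

Record psSet := PsSet {
  psset :> sSet;
  bpt : forall k, psset k;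
  face_bpt : forall k (i : 'I_k.+2), face i (bpt k.+1) = bpt k;
  degen_bpt : forall k (i : 'I_k.+1), degen i (bpt k) = bpt k.+1
}.

Arguments bpt X k : simpl never, rename.

Record subsSet (X : sSet) := SubsSet {
  insub_s :> forall k, pred (X k);
  face_sub : forall k (i : 'I_k.+2) (x : X k.+1),
    insub_s x -> insub_s (face i x);
  degen_sub : forall k (i : 'I_k.+1) (x : X k),
    insub_s x -> insub_s (degen i x)
}.

(* X / A: the basepoint [None] is the collapsed A; for empty A this is X with a
   disjoint basepoint. *)
Section Collapse.
Variables (X : sSet) (A : subsSet X).

Definition csimp k : choiceType := option {x : X k | ~~ A k x}.

Definition cpr k (x : X k) : csimp k := insub x.

Definition cface k (i : 'I_k.+2) (x : csimp k.+1) : csimp k :=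
  obind (fun u => cpr (face i (val u))) x.

Definition cdegen k (i : 'I_k.+1) (x : csimp k) : csimp k.+1 :=
  obind (fun u => cpr (degen i (val u))) x.

Lemma cpr_sub k (x : X k) : A k x -> cpr x = None.
Proof. by move=> Ax; rewrite /cpr insubF ?Ax. Qed.

Lemma cfaceE k (i : 'I_k.+2) (x : X k.+1) : cface i (cpr x) = cpr (face i x).
Proof.
rewrite {1}/cpr /cface; case: insubP => [u _ <- //|/negPn Ax].
by rewrite cpr_sub ?face_sub.
Qed.

Lemma cdegenE k (i : 'I_k.+1) (x : X k) : cdegen i (cpr x) = cpr (degen i x).
Proof.
rewrite {1}/cpr /cdegen; case: insubP => [u _ <- //|/negPn Ax].
by rewrite cpr_sub ?degen_sub.
Qed.

Lemma cprP k (x : csimp k) : x = None \/ exists y, x = cpr y.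
Proof. by case: x => [u|]; [right; exists (val u); rewrite /cpr valK|left]. Qed.

Fact cface_face k (i : 'I_k.+2) (j : 'I_k.+3) (x : csimp k.+2) :
  (i < j)%N -> cface i (cface j x) = cface (inord j.-1) (cface (inord i) x).
Proof.
move=> ij; case: (cprP x) => [->//|[y ->]].
by rewrite !cfaceE face_face.
Qed.

Fact cdegen_degen k (i j : 'I_k.+1) (x : csimp k) :
  (i <= j)%N -> cdegen (inord i) (cdegen j x) = cdegen (inord j.+1) (cdegen i x).
Proof.
move=> ij; case: (cprP x) => [->//|[y ->]].
by rewrite !cdegenE degen_degen.
Qed.

Fact cface_degen_lt k (i : 'I_k.+3) (j : 'I_k.+2) (x : csimp k.+1) :
  (i < j)%N -> cface i (cdegen j x) = cdegen (inord j.-1) (cface (inord i) x).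
Proof.
move=> ij; case: (cprP x) => [->//|[y ->]].
by rewrite !(cfaceE, cdegenE) face_degen_lt.
Qed.

Fact cface_degen_id k (i : 'I_k.+2) (j : 'I_k.+1) (x : csimp k) :
  (i == j :> nat) || (i == j.+1 :> nat) -> cface i (cdegen j x) = x.
Proof.
move=> ij; case: (cprP x) => [->//|[y ->]].
by rewrite !(cfaceE, cdegenE) face_degen_id.
Qed.

Fact cface_degen_gt k (i : 'I_k.+3) (j : 'I_k.+2) (x : csimp k.+1) :
  (j.+1 < i)%N -> cface i (cdegen j x) = cdegen (inord j) (cface (inord i.-1) x).
Proof.
move=> ij; case: (cprP x) => [->//|[y ->]].
by rewrite !(cfaceE, cdegenE) face_degen_gt.
Qed.

Definition collapse : psSet :=
  @PsSet (SSet cface_face cdegen_degen cface_degen_lt cface_degen_id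
            cface_degen_gt)
    (fun k => None) (fun k i => erefl) (fun k i => erefl).

End Collapse.

Local Ltac ordlia :=
  rewrite /= ?/bump ?/unbump ?inordK /=;
  repeat match goal with
    |- context [nat_of_bool ?b] => case: (boolP b) => ? /=
  end; lia.

Section Flags.
Variable V : vectType rat.

Definition is_flag k (f : {ffun 'I_k.+1 -> {vspace V}}) : bool :=
  [forall i : 'I_k.+1, forall j : 'I_k.+1, (i <= j)%N ==> (f i <= f j)%VS].

Definition flag k : choiceType := {f : {ffun 'I_k.+1 -> {vspace V}} | is_flag f}.

Definition flag_fun k (f : flag k) : 'I_k.+1 -> {vspace V} := val f.

Lemma flag_le k (f : flag k) (i j : 'I_k.+1) : (i <= j)%N -> (flag_fun f i <= flag_fun f j)%VS.
Proof.
by move=> ij; have /forallP/(_ i)/forallP/(_ j)/implyP := valP f; apply.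
Qed.

Fact dflag_subproof k (i : 'I_k.+2) (f : flag k.+1) :
  is_flag [ffun j : 'I_k.+1 => flag_fun f (lift i j)].
Proof.
apply/forallP=> a; apply/forallP=> b; apply/implyP=> ab; rewrite !ffunE.
apply: flag_le; ordlia.
Qed.

Definition dflag k (i : 'I_k.+2) (f : flag k.+1) : flag k :=
  Sub [ffun j : 'I_k.+1 => flag_fun f (lift i j)] (dflag_subproof i f).

Fact sflag_subproof k (i : 'I_k.+1) (f : flag k) :
  is_flag [ffun j : 'I_k.+2 => flag_fun f (inord (unbump i j))].
Proof.
apply/forallP=> a; apply/forallP=> b; apply/implyP=> ab; rewrite !ffunE.
apply: flag_le.
have := ltn_ord a; have := ltn_ord b; have := ltn_ord i => ? ? ?.
ordlia.
Qed.

(* [unbump i] is the monotone surjection hitting i twice, as [lift i] is the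
   monotone injection missing i. *)
Definition sflag k (i : 'I_k.+1) (f : flag k) : flag k.+1 :=
  Sub [ffun j : 'I_k.+2 => flag_fun f (inord (unbump i j))] (sflag_subproof i f).

Lemma flagP k (f g : flag k) : flag_fun f =1 flag_fun g -> f = g.
Proof. by move=> fg; apply/val_inj/ffunP. Qed.

Lemma dflagE k (i : 'I_k.+2) (f : flag k.+1) j :
  flag_fun (dflag i f) j = flag_fun f (lift i j).
Proof. by rewrite /flag_fun /= ffunE. Qed.

Lemma sflagE k (i : 'I_k.+1) (f : flag k) j :
  flag_fun (sflag i f) j = flag_fun f (inord (unbump i j)).
Proof. by rewrite /flag_fun /= ffunE. Qed.

Fact dflag_dflag k (i : 'I_k.+2) (j : 'I_k.+3) (x : flag k.+2) :
  (i < j)%N -> dflag i (dflag j x) = dflag (inord j.-1) (dflag (inord i) x).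
Proof.
move=> ij; apply: flagP => l; rewrite !dflagE; congr flag_fun; apply: val_inj.
have := ltn_ord i; have := ltn_ord j; have := ltn_ord l => ? ? ?.
ordlia.
Qed.

Fact sflag_sflag k (i j : 'I_k.+1) (x : flag k) :
  (i <= j)%N -> sflag (inord i) (sflag j x) = sflag (inord j.+1) (sflag i x).
Proof.
move=> ij; apply: flagP => l; rewrite !sflagE; congr flag_fun; apply: val_inj.
have := ltn_ord i; have := ltn_ord j; have := ltn_ord l => ? ? ?.
ordlia.
Qed.

Fact dflag_sflag_lt k (i : 'I_k.+3) (j : 'I_k.+2) (x : flag k.+1) :
  (i < j)%N -> dflag i (sflag j x) = sflag (inord j.-1) (dflag (inord i) x).
Proof.
move=> ij; apply: flagP => l; rewrite !(sflagE, dflagE); congr flag_fun.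
apply: val_inj.
have := ltn_ord i; have := ltn_ord j; have := ltn_ord l => ? ? ?.
ordlia.
Qed.

Fact dflag_sflag_id k (i : 'I_k.+2) (j : 'I_k.+1) (x : flag k) :
  (i == j :> nat) || (i == j.+1 :> nat) -> dflag i (sflag j x) = x.
Proof.
move=> ij; apply: flagP => l; rewrite !(sflagE, dflagE); congr flag_fun.
apply: val_inj.
have := ltn_ord i; have := ltn_ord j; have := ltn_ord l => ? ? ?.
ordlia.
Qed.

Fact dflag_sflag_gt k (i : 'I_k.+3) (j : 'I_k.+2) (x : flag k.+1) :
  (j.+1 < i)%N -> dflag i (sflag j x) = sflag (inord j) (dflag (inord i.-1) x).
Proof.
move=> ij; apply: flagP => l; rewrite !(sflagE, dflagE); congr flag_fun.
apply: val_inj.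
have := ltn_ord i; have := ltn_ord j; have := ltn_ord l => ? ? ?.
ordlia.
Qed.

Definition flags : sSet :=
  SSet dflag_dflag sflag_sflag dflag_sflag_lt dflag_sflag_id dflag_sflag_gt.

Definition bad_flag k (f : flag k) : bool :=
  (flag_fun f ord0 != 0%VS) || (flag_fun f ord_max != fullv).

Lemma bad_flag_le k l (f : flag k) (g : flag l) :
  (flag_fun f ord0 <= flag_fun g ord0)%VS ->
  (flag_fun g ord_max <= flag_fun f ord_max)%VS ->
  bad_flag f -> bad_flag g.
Proof.
move=> fg gf; apply: contraLR; rewrite !negb_or !negbK => /andP[/eqP g0 /eqP gm].
by move: fg gf; rewrite g0 gm subv0 => -> /=; rewrite eqEsubv subvf.
Qed.

Fact bad_dflag k (i : 'I_k.+2) (f : flag k.+1) : bad_flag f -> bad_flag (dflag i f).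
Proof.
by apply: bad_flag_le; rewrite dflagE; apply: flag_le; ordlia.
Qed.

Fact bad_sflag k (i : 'I_k.+1) (f : flag k) : bad_flag f -> bad_flag (sflag i f).
Proof.
by apply: bad_flag_le; rewrite sflagE; apply: flag_le; rewrite //= -ltnS.
Qed.

Definition bad_flags : subsSet flags := @SubsSet flags bad_flag bad_dflag bad_sflag.

Definition SST : psSet := collapse bad_flags.

Definition SST_pr k (f : flag k) : SST k := cpr bad_flags (k := k) f.

End Flags.

Section Smash.
Variables X Y : psSet.

Definition pface k (i : 'I_k.+2) (z : X k.+1 * Y k.+1) : X k * Y k :=
  (face i z.1, face i z.2).

Definition pdegen k (i : 'I_k.+1) (z : X k * Y k) : X k.+1 * Y k.+1 :=
  (degen i z.1, degen i z.2).

Definition sprod : sSet.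
Proof.
refine (@SSet (fun k => (X k * Y k)%type) pface pdegen _ _ _ _ _);
  move=> k i j [x y] ij; rewrite /pface /pdegen /=.
- by congr pair; apply: face_face.
- by congr pair; apply: degen_degen.
- by congr pair; apply: face_degen_lt.
- by congr pair; apply: face_degen_id.
- by congr pair; apply: face_degen_gt.
Defined.

Definition in_wedge k (z : sprod k) : bool := (z.1 == bpt X k) || (z.2 == bpt Y k).

Definition wedge : subsSet sprod.
Proof.
refine (@SubsSet sprod in_wedge _ _) => k i [x y] /orP[] /= /eqP ->;
  by rewrite /in_wedge /= !(face_bpt, degen_bpt) eqxx ?orbT.
Defined.

Definition smash : psSet := collapse wedge.

Definition smash_pair k (x : X k) (y : Y k) : smash k := cpr wedge (k := k) (x, y).

End Smash.

(* Normalized chains modulo the chains of the basepoint: the free Q-vector space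
   on the nondegenerate simplices other than the basepoint, [gen x] being the
   class of x. *)
Section Chains.
Variable X : psSet.

Definition degenerate k : X k -> Prop :=
  match k with
  | 0 => fun _ => False
  | k'.+1 => fun x => exists (i : 'I_k'.+1) (y : X k'), x = degen i y
  end.

Definition nondeg k (x : X k) : bool := (x != bpt X k) && ~~ `[< degenerate x >].

Definition ndsimp k : choiceType := {x : X k | nondeg x}.

Definition chains k : lmodType rat := {freeg (ndsimp k) / rat}.

Definition gen k (x : X k) : chains k :=
  if (insub x : option (ndsimp k)) is Some u then << u >> else 0.

Definition bd k : chains k -> chains k.-1 :=
  match k with
  | 0 => fun _ => 0
  | k'.+1 => fglift (fun u : ndsimp k'.+1 =>
      \sum_(i < k'.+2) (-1) ^+ i *: gen (face i (val u)))
  end.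

End Chains.

Arguments bd {X k} _ : simpl never.

Lemma fglift_is_linear (K : choiceType) (M : lmodType rat) (f : K -> M) :
  linear (fglift f : {freeg K / rat} -> M).
Proof.
have addf : additive (fglift f : {freeg K / rat} -> M) := lift_is_additive f.
pose F := GRing.isZmodMorphism.Build _ _ _ addf.
pose g : {additive {freeg K / rat} -> M} := HB.pack (fglift f) F.
have gE x : fglift f x = g x by [].
move=> a x y; rewrite !gE raddfD; congr (_ + _).
have -> : a *: x = \sum_(z <- dom x) << a * coeff z x *g z >> by [].
rewrite -[in RHS](freeg_sumE x) !raddf_sum /=.
by apply: eq_bigr => z _; rewrite !liftU scalerA.
Qed.

Lemma bd_is_linear (X : psSet) k : linear (@bd X k).
Proof.
case: k => [|k] a x y; first by rewrite /bd scaler0 addr0.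
exact: fglift_is_linear.
Qed.
HB.instance Definition _ (X : psSet) k :=
  GRing.isLinear.Build rat (chains X k) (chains X k.-1) *:%R (@bd X k)
    (@bd_is_linear X k).

Section ChainComplex.
Variable X : psSet.

Lemma gen_bpt k : gen (bpt X k) = 0.
Proof. by rewrite /gen insubF // /nondeg eqxx. Qed.

Lemma gen_degen k (i : 'I_k.+1) (x : X k) : gen (degen i x) = 0.
Proof.
rewrite /gen insubF //; apply/negbTE; rewrite negb_and negbK orbC.
by apply/orP; left; apply/negPn/asboolP; exists i, x.
Qed.

Lemma genP k (x : X k) :
  [\/ x = bpt X k, degenerate x | exists2 u : ndsimp X k, x = val u & gen x = << u >>].
Proof.
rewrite /gen; case: insubP => [u _ <-|]; first by constructor 3; exists u.
rewrite negb_and !negbK => /orP[/eqP|/asboolP]; first by constructor 1.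
by constructor 2.
Qed.

Lemma bd_gen k (x : X k.+1) :
  bd (gen x) = \sum_(i < k.+2) (-1) ^+ i *: gen (face i x).
Proof.
case: (genP x) => [->|[j [y ->]]|[u -> ->]]; last by rewrite /bd liftU scale1r.
  rewrite gen_bpt linear0 big1 // => i _.
  by rewrite face_bpt gen_bpt scaler0.
rewrite gen_degen linear0; apply/esym.
have j0 : (j < k.+2)%N := ltnW (ltn_ord j).
have j1 : (j.+1 < k.+2)%N := ltn_ord j.
rewrite (bigD1 (Ordinal j0)) //= (bigD1 (Ordinal j1)) /=; last first.
  by rewrite -val_eqE /= -[X in X != _]addn1 -[X in _ != X]addn0 eqn_add2l.
rewrite !face_degen_id ?eqxx ?orbT // addrA exprS mulN1r scaleNr subrr add0r.
rewrite big1 // => i; rewrite -!val_eqE /= => /andP[i0 i1].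
case: k {x} y j j0 j1 i i0 i1 => [|k] y j j0 j1 i i0 i1.
  by have := ltn_ord i; have := ltn_ord j; lia.
case: (ltngtP i j) => [ij|ij|ij]; last by rewrite ij eqxx in i0.
  by rewrite face_degen_lt // gen_degen scaler0.
rewrite face_degen_gt; last by lia.
by rewrite gen_degen scaler0.
Qed.

Lemma bd_bd k (c : chains X k.+2) : bd (bd c) = 0.
Proof.
have -> : c = \sum_(u <- dom c) coeff u c *: << u >>.
  rewrite -[LHS]freeg_sumE; apply: eq_bigr => u _.
  by apply/eqP/freeg_eqP => w; rewrite coeffZ !coeffU mul1r.
rewrite !linear_sum big1 // => u _; rewrite !linearZ /=.
suff -> : bd (bd (<< u >> : chains X k.+2)) = 0 by rewrite scaler0.
have -> : << u >> = gen (val u) by rewrite /gen valK.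
move: (val u) => x; rewrite bd_gen linear_sum /=.
under eq_bigr => j _ do rewrite linearZ /= bd_gen scaler_sumr.
rewrite pair_bigA /= (bigID (fun z : 'I_k.+3 * 'I_k.+2 => (z.2 < z.1)%N)) /=.
rewrite (reindex_onto (fun z : 'I_k.+3 * 'I_k.+2 => (inord z.2.+1, inord z.1))
          (fun z => (inord z.2, inord z.1.-1))) /=; last first.
  move=> [j i] /= ij; have := ltn_ord i; have := ltn_ord j => ? ?.
  congr pair; apply: val_inj; rewrite /= !inordK; lia.
rewrite -[X in _ + X]opprK -sumrN; apply/eqP; rewrite subr_eq0; apply/eqP.
have P (j : 'I_k.+3) (i : 'I_k.+2) :
    ((inord j : 'I_k.+2) < (inord i.+1 : 'I_k.+3))%N &&
    ((inord (inord j : 'I_k.+2), inord (inord i.+1 : 'I_k.+3).-1) == (j, i))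
    = ~~ (i < j)%N.
  have ? := ltn_ord i; have ? := ltn_ord j; rewrite -leqNgt xpair_eqE -!val_eqE /=.
  rewrite (@inordK k.+2 i.+1) //=; have [ji|ij] := leqP j i.
    by rewrite !inordK ?eqxx ?andbT //; lia.
  apply/negbTE; rewrite !negb_and; case: (ltnP j k.+2) => jk.
    by rewrite inordK // -leqNgt ij.
  have ? := ltn_ord (inord j : 'I_k.+2).
  by rewrite (@inordK k.+2 (inord j : 'I_k.+2)); lia.
apply: eq_big => [[j i]|[j i]]; first exact: P.
rewrite /= P -leqNgt => ji; have ? := ltn_ord i; have ? := ltn_ord j.
have ej : (inord j : 'I_k.+2) = j :> nat by rewrite inordK; lia.
have ei : (inord i.+1 : 'I_k.+3) = i.+1 :> nat by rewrite inordK.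
rewrite [face i (face j x)](_ : _ = face (inord j) (face (inord i.+1) x)); last first.
  rewrite [RHS]face_face ?ei ?ej //.
  by congr (face _ (face _ _)); apply: val_inj; rewrite /= inordK ?ej.
by rewrite ei ej exprS mulN1r scaleNr !scalerA [in LHS]mulrC.
Qed.

End ChainComplex.

Section LmodQuotient.
Variables (R : nzRingType) (M : lmodType R) (S : zmodClosed M).
Variable SZ : GRing.scaler_closed S.

Definition lquot_of of GRing.scaler_closed S := Quotient.quot S.
Local Notation lquot := (lquot_of SZ).
HB.instance Definition _ := GRing.Zmodule.on lquot.

Definition lquot_pi : M -> lquot := \pi_(Quotient.quot S).

Definition lquot_repr (x : lquot) : M := repr (x : Quotient.quot S).

Definition lquot_scale (a : R) (x : lquot) : lquot :=
  lquot_pi (a *: lquot_repr x).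

Lemma lquot_piP (x y : M) : (lquot_pi x = lquot_pi y) <-> x - y \in S.
Proof.
by rewrite Quotient.idealrBE; split=> [h|/eqP //]; apply/eqP.
Qed.

Lemma lquot_reprK (x : lquot) : lquot_pi (lquot_repr x) = x.
Proof. exact: reprK. Qed.

Lemma lquot_piD : {morph lquot_pi : x y / x + y}.
Proof. by move=> x y; rewrite /lquot_pi raddfD. Qed.

Lemma lquot_piZ a (x : M) : lquot_scale a (lquot_pi x) = lquot_pi (a *: x).
Proof.
by apply/lquot_piP; rewrite -scalerBr; apply/SZ/lquot_piP/lquot_reprK.
Qed.

Fact lquot_scalerA a b x : lquot_scale a (lquot_scale b x) = lquot_scale (a * b) x.
Proof. by rewrite -[x]lquot_reprK !lquot_piZ scalerA. Qed.

Fact lquot_scale1r : left_id 1 lquot_scale.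
Proof. by move=> x; rewrite -[x]lquot_reprK lquot_piZ scale1r. Qed.

Fact lquot_scalerDr : right_distributive lquot_scale +%R.
Proof.
move=> a x y; rewrite -[x]lquot_reprK -[y]lquot_reprK.
by rewrite -lquot_piD !lquot_piZ scalerDr lquot_piD.
Qed.

Fact lquot_scalerDl x : {morph lquot_scale^~ x : a b / a + b}.
Proof.
by move=> a b; rewrite -[x]lquot_reprK !lquot_piZ scalerDl lquot_piD.
Qed.

HB.instance Definition _ := GRing.Zmodule_isLmodule.Build R lquot
  lquot_scalerA lquot_scale1r lquot_scalerDr lquot_scalerDl.

End LmodQuotient.

Section Homology.
Variables (X : psSet) (k : nat).

Definition cyc_pred : pred (chains X k) := fun c => bd c == 0.

Fact cyc_submod : submod_closed cyc_pred.
Proof.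
split=> [|a x y]; first by rewrite unfold_in /cyc_pred linear0.
rewrite !unfold_in /cyc_pred => /eqP x0 /eqP y0.
by rewrite linearP /= x0 y0 scaler0 addr0.
Qed.
HB.instance Definition _ := GRing.isSubmodClosed.Build rat (chains X k) cyc_pred
  cyc_submod.

Definition cycles := {c : chains X k | cyc_pred c}.
HB.instance Definition _ := [isSub of cycles for @sval _ _].
HB.instance Definition _ := [Choice of cycles by <:].
HB.instance Definition _ := [SubChoice_isSubLmodule of cycles by <:].

Definition bnd_pred : pred cycles :=
  fun z => `[< exists b : chains X k.+1, bd b = val z >].

Fact bnd_submod : submod_closed bnd_pred.
Proof.
split=> [|a x y]; first by apply/asboolP; exists 0; rewrite !linear0.
move=> /asboolP[b bx] /asboolP[c cy]; apply/asboolP; exists (a *: b + c).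
by rewrite [LHS]linearP [RHS]linearP /= -bx -cy.
Qed.
HB.instance Definition _ := GRing.isSubmodClosed.Build rat cycles bnd_pred
  bnd_submod.

Definition homology : lmodType rat :=
  lquot_of (bnd_submod : GRing.scaler_closed bnd_pred).

End Homology.

(* The class of a cycle; the value 0 on other chains is a totalization. *)
Definition hclass (X : psSet) k (c : chains X k) : homology X k :=
  lquot_pi _ (insubd (0 : cycles X k) c).

Definition hrepr (X : psSet) k (a : homology X k) : chains X k :=
  val (lquot_repr a).

Definition push (X Y : psSet) (f : forall k, X k -> Y k) k : chains X k -> chains Y k :=
  fglift (fun u : ndsimp X k => gen (f k (val u))).

Section EilenbergZilber.

(* s_{b_q-1} ... s_{b_1-1} x, for b listing b_1 - 1, ..., b_q - 1. *)
Fixpoint sdeg (X : sSet) k (x : X k) q : ('I_q -> nat) -> X (q + k)%N :=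
  match q with
  | 0 => fun _ => x
  | q'.+1 => fun b =>
      degen (inord (b ord_max)) (sdeg x (fun j => b (widen_ord (leqnSn q') j)))
  end.

Definition cast_simp (X : sSet) k l (e : k = l) (x : X k) : X l :=
  eq_rect k (fun d => X d : Type) x l e.

Variables X Y : psSet.

(* Shuffles as permutations: s lists a_1 - 1, ..., a_p - 1, b_1 - 1, ..., b_q - 1. *)
Definition shuffle p q (s : 'S_(p + q)) : bool :=
  [forall i : 'I_p, forall j : 'I_p, (i < j)%N ==> (s (lshift q i) < s (lshift q j))%N]
  && [forall i : 'I_q, forall j : 'I_q,
        (i < j)%N ==> (s (rshift p i) < s (rshift p j))%N].

Definition EZ_simp p q (x : X p) (y : Y q) : chains (smash X Y) (p + q) :=
  \sum_(s : 'S_(p + q) | shuffle s) (-1) ^+ s *: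
    gen (smash_pair (cast_simp (addnC q p) (sdeg x (fun j : 'I_q => s (rshift p j))))
                    (sdeg y (fun i : 'I_p => s (lshift q i)))).

Definition EZ p q (c : chains X p) (d : chains Y q) : chains (smash X Y) (p + q) :=
  fglift (fun u : ndsimp X p =>
    fglift (fun v : ndsimp Y q => EZ_simp (val u) (val v)) d) c.

End EilenbergZilber.

Section JoinProduct.
Variables m n : nat.

Definition phi (v : 'rV[rat]_m) : 'rV[rat]_(m + n) := row_mx v 0.
Definition psi (w : 'rV[rat]_n) : 'rV[rat]_(m + n) := row_mx 0 w.

Fact phi_is_linear : linear phi.
Proof. by move=> a u v; rewrite /phi scale_row_mx add_row_mx scaler0 addr0. Qed.
HB.instance Definition _ :=
  GRing.isLinear.Build rat 'rV[rat]_m 'rV[rat]_(m + n) *:%R phi phi_is_linear.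

Fact psi_is_linear : linear psi.
Proof. by move=> a u v; rewrite /psi scale_row_mx add_row_mx scaler0 addr0. Qed.
HB.instance Definition _ :=
  GRing.isLinear.Build rat 'rV[rat]_n 'rV[rat]_(m + n) *:%R psi psi_is_linear.

Fact flag_sum_subproof k (f : flag 'rV[rat]_m k) (g : flag 'rV[rat]_n k) :
  is_flag [ffun j : 'I_k.+1 =>
    (linfun phi @: flag_fun f j + linfun psi @: flag_fun g j)%VS].
Proof.
apply/forallP=> a; apply/forallP=> b; apply/implyP=> ab; rewrite !ffunE.
by apply: addvS; apply: limgS; apply: flag_le.
Qed.

Definition flag_sum k (f : flag 'rV[rat]_m k) (g : flag 'rV[rat]_n k) :
    flag 'rV[rat]_(m + n) k :=
  Sub [ffun j : 'I_k.+1 =>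
    (linfun phi @: flag_fun f j + linfun psi @: flag_fun g j)%VS]
    (flag_sum_subproof f g).

Definition theta k (x : SST 'rV[rat]_m k) (y : SST 'rV[rat]_n k) :
    SST 'rV[rat]_(m + n) k :=
  match x, y with
  | Some f, Some g => SST_pr (flag_sum (val f) (val g))
  | _, _ => None
  end.

Definition theta_smash k (z : smash (SST 'rV[rat]_m) (SST 'rV[rat]_n) k) :
    SST 'rV[rat]_(m + n) k :=
  if z is Some u then theta (val u).1 (val u).2 else None.

End JoinProduct.

Definition St n : lmodType rat := homology (SST 'rV[rat]_n) n.

(* EZ and theta_smash induce chain maps, so the class does not depend on the
   chosen representatives and mu is bilinear, that is, a linear map on the
   tensor product. *)
Definition mu m n (a : St m) (b : St n) : St (m + n) :=
  hclass (push (@theta_smash m n) (EZ (hrepr a) (hrepr b))).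

Section Apartment.
Variables (V : vectType rat) (n : nat) (v : n.-tuple V).

Fact apt_flag_subproof (s : 'S_n) :
  is_flag [ffun i : 'I_n.+1 =>
    <<[seq tnth v (s j) | j : 'I_n <- enum 'I_n & (j < i)%N]>>%VS].
Proof.
apply/forallP=> a; apply/forallP=> b; apply/implyP=> ab; rewrite !ffunE.
apply: sub_span => _ /mapP[j + ->]; rewrite mem_filter => /andP[ja je].
by apply: map_f; rewrite mem_filter je (leq_trans ja ab).
Qed.

(* For a basis the last subspace, the span of all the v_j, is V. *)
Definition apt_flag (s : 'S_n) : flag V n :=
  Sub [ffun i : 'I_n.+1 =>
    <<[seq tnth v (s j) | j : 'I_n <- enum 'I_n & (j < i)%N]>>%VS] (apt_flag_subproof s).

Definition apt_chain : chains (SST V) n :=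
  \sum_(s : 'S_n) (-1) ^+ s *: gen (SST_pr (apt_flag s)).

Definition apartment : homology (SST V) n := hclass apt_chain.

End Apartment.

Lemma face_SST_pr (V : vectType rat) k (i : 'I_k.+2) (f : flag V k.+1) :
  face i (SST_pr f) = SST_pr (dflag i f).
Proof. exact: (@cfaceE _ (bad_flags V) k i f). Qed.

Lemma bad_SST_pr (V : vectType rat) k (f : flag V k) :
  bad_flag f -> SST_pr f = bpt (SST V) k.
Proof. exact: (@cpr_sub _ (bad_flags V) k f). Qed.

Lemma apt_flagE (V : vectType rat) n (v : n.-tuple V) (s : 'S_n) (l : 'I_n.+1) :
  flag_fun (apt_flag v s) l =
    <<[seq tnth v (s j) | j : 'I_n <- enum 'I_n & (j < l)%N]>>%VS.
Proof. by rewrite /flag_fun /= ffunE. Qed.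

Lemma apt_chain_cycle (V : vectType rat) n (v : n.-tuple V) :
  basis_of fullv v -> bd (apt_chain v) = 0.
Proof.
case: n v => [|n] v hv; first by rewrite /bd.
rewrite linear_sum /=.
under eq_bigr => s _ do rewrite linearZ /= bd_gen scaler_sumr.
rewrite exchange_big big1 //= => i _.
under eq_bigr => s _ do rewrite face_SST_pr.
have [i0|i0] := eqVneq (i : nat) 0%N.
  rewrite big1 // => s _; rewrite bad_SST_pr ?gen_bpt ?scaler0 //.
  apply/orP; left; rewrite dflagE apt_flagE.
  have v0 : tnth v (s ord0) != 0.
    by apply: (free_not0 (basis_free hv)); rewrite mem_tnth.
  apply: contraNneq v0 => sp0; rewrite -memv0 -sp0; apply: memv_span.
  by apply: map_f; rewrite mem_filter mem_enum /= /bump i0.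
have [im|im] := eqVneq (i : nat) n.+1.
  rewrite big1 // => s _; rewrite bad_SST_pr ?gen_bpt ?scaler0 //.
  apply/orP; right; rewrite dflagE apt_flagE.
  apply/negP => /eqP sp; have := dim_span
    [seq tnth v (s j) | j : 'I_n.+1 <- enum 'I_n.+1 & (j < lift i ord_max)%N].
  rewrite sp -(span_basis hv) (eqP (basis_free hv)) size_tuple size_map size_filter.
  apply/negP; rewrite -ltnNge -[X in (_ < X)%N](size_enum_ord n.+1).
  rewrite ltn_neqAle count_size -all_count andbT; apply/allPn; exists ord_max.
    by rewrite mem_enum.
  by rewrite /= /bump im ltnn add0n ltnn.
have [t0 t1] : (i.-1 < n.+1 /\ i < n.+1)%N by have := ltn_ord i; lia.
pose t : 'S_n.+1 := tperm (Ordinal t0) (Ordinal t1).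
have tne : Ordinal t0 != Ordinal t1 by rewrite -val_eqE /=; lia.
pose F (s : 'S_n.+1) : chains (SST V) n :=
  (-1) ^+ s *: ((-1) ^+ i *: gen (SST_pr (dflag i (apt_flag v s)))).
have Ft s : F (t * s)%g = - F s.
  rewrite /F odd_mul_tperm tne signr_addb mulN1r scaleNr; congr (- (_ *: (_ *: gen _))).
  congr SST_pr; apply: flagP => l; rewrite !dflagE !apt_flagE.
  set h := lift i l; apply: eq_span => w; have hi : h != i :> nat.
    by rewrite /h /= /bump; case: leqP => ?; lia.
  have th (j : 'I_n.+1) : (t j < h)%N = (j < h)%N.
    rewrite /t; case: tpermP => [->|->|//] /=; move: hi; rewrite /h /= /bump;
      by case: leqP => ? ?; apply/idP/idP; lia.
  apply/mapP/mapP => -[j]; rewrite mem_filter mem_enum andbT => jh ->; exists (t j).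
  - by rewrite mem_filter mem_enum th jh.
  - by rewrite permM.
  - by rewrite mem_filter mem_enum th jh.
  - by rewrite permM /t tpermK.
set S := LHS; have : S = - S.
  rewrite {1}/S (reindex_inj (mulgI t)) -sumrN; apply: eq_bigr => s _; exact: Ft.
move/eqP; rewrite -addr_eq0 -mulr2n -scaler_nat scaler_eq0 Num.Theory.pnatr_eq0 /=.
by move/eqP.
Qed.

(* Main.v *)
Require Import Defs.
From HB Require Import structures.
From mathcomp Require Import freeg.
From mathcomp Require Import all_boot all_order all_algebra.
From mathcomp Require Import perm zify boolp.
Import GRing.Theory.
Local Open Scope ring_scope.

Set Implicit Arguments.
Unset Strict Implicit.
Unset Printing Implicit Defensive.

(** The identity already holds between chains. A nondegenerate simplex of
    [SST V] is a strictly increasing flag, so there are no chains above degree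
    [\dim V]; hence a homology class of degree [\dim V] has exactly one
    representing cycle, and the representatives entering [mu] are the apartment
    chains themselves ([hrepr_apartment]).

    The Eilenberg-Zilber map turns the two apartment chains into a signed sum
    over triples [(t, u, s)] of an order of the first basis, an order of the
    second, and a shuffle. The pair of degenerate flags indexed by such a triple
    has as its flag sum the flag of the joint basis in the order where the
    vectors of the first basis, ordered by [t], occupy the first set of
    positions of the shuffle, and those of the second, ordered by [u], the other
    one. This order is [s^-1 * block_perm t u] ([flag_sum_shuffle]). Every order
    of the joint basis arises in this way from exactly one triple, because [t]
    and [u] record the order induced on each of the two bases and [s] the
    positions occupied ([sum_shuffles]); and the sign of the order is the product
    of the three signs ([sign_block_perm]). The sum is therefore the apartment
    chain of the joint basis. *)

(** * Shuffles and block permutations *)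

Section BlockPerm.
Variables (m n : nat) (s : 'S_m) (t : 'S_n).

Let block_fun (x : 'I_(m + n)) : 'I_(m + n) :=
  match split x with inl i => lshift n (s i) | inr j => rshift m (t j) end.

Fact block_fun_inj : injective block_fun.
Proof.
move=> x y; rewrite /block_fun.
case: (splitP x) => i xi; case: (splitP y) => j yj /eqP;
  rewrite ?eq_lshift ?eq_rshift ?eq_lrshift ?eq_rlshift // => /eqP/perm_inj ij;
  by apply: val_inj; rewrite /= xi yj ij.
Qed.

Definition block_perm : 'S_(m + n) := perm block_fun_inj.

Lemma block_perm_lshift i : block_perm (lshift n i) = lshift n (s i).
Proof. by rewrite permE /block_fun (unsplitK (inl i)). Qed.

Lemma block_perm_rshift j : block_perm (rshift m j) = rshift m (t j).
Proof. by rewrite permE /block_fun (unsplitK (inr j)). Qed.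

(** The permutation matrix of [block_perm] is block diagonal, and a sign is a
    determinant. *)
Lemma sign_block_perm : (-1) ^+ block_perm = (-1) ^+ s * (-1) ^+ t :> rat.
Proof.
rewrite -!det_perm -(det_ublock _ 0); congr (\det _).
apply/matrixP=> x y; rewrite -(splitK x) -(splitK y).
case: (split x) => i; case: (split y) => j /=;
  rewrite ?(block_mxEul, block_mxEur, block_mxEdl, block_mxEdr) !mxE
    ?block_perm_lshift ?block_perm_rshift
    ?eq_lshift ?eq_rshift ?eq_lrshift ?eq_rlshift //.
Qed.

End BlockPerm.

Lemma card_ord_lt m l : (l <= m)%N -> #|[set i : 'I_m | (i < l)%N]| = l.
Proof.
by move=> lm; rewrite -sum1dep_card (big_ord_narrow lm) sum1_card card_ord.
Qed.

Definition increasing m (f : 'I_m -> nat) : bool :=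
  [forall i : 'I_m, forall j : 'I_m, (i < j)%N ==> (f i < f j)%N].

Lemma increasingP m (f : 'I_m -> nat) :
  reflect {mono f : i j / (i < j)%N} (increasing f).
Proof.
apply: (iffP forallP) => [incr i j|f_mono i]; last first.
  by apply/forallP=> j; rewrite f_mono implybb.
have [ij|ji|/val_inj->] := ltngtP i j; last by rewrite ltnn.
  by have /forallP/(_ j) := incr i; rewrite ij.
apply/negbTE; rewrite -leqNgt ltnW //.
by have /forallP/(_ i) := incr j; rewrite ji.
Qed.

(** The indices with values below [l] form an initial segment, which its size
    determines. *)
Lemma increasing_lt_card m (f : 'I_m -> nat) (l : nat) (i : 'I_m) :
  increasing f -> (i < #|[set j | (f j < l)%N]|)%N = (f i < l)%N.
Proof.
move=> /increasingP f_mono; have [fl|lf] := ltnP (f i) l.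
  rewrite -(card_ord_lt (ltn_ord i)); apply/subset_leq_card/subsetP=> j.
  by rewrite !inE ltnS leqNgt -f_mono -leqNgt => /leq_ltn_trans; apply.
apply/negbTE; rewrite -leqNgt -[X in (_ <= X)%N](card_ord_lt (ltnW (ltn_ord i))).
apply/subset_leq_card/subsetP=> j.
by rewrite !inE -f_mono => /leq_trans; apply.
Qed.

(** The permutation that sorts [f] is the inverse of the one sending [i] to the
    rank of [f i] among the values of [f]. *)
Lemma sorting_perm m (f : 'I_m -> nat) : injective f ->
  exists s0 : 'S_m, forall s : 'S_m, increasing (f \o s) = (s == s0).
Proof.
move=> f_inj; pose lower i := [set j : 'I_m | (f j < f i)%N].
have lower_lt i : (#|lower i| < m)%N.
  rewrite -[X in (_ < X)%N](card_ord m) -cardsT; apply: proper_card.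
  by rewrite properT; apply/eqP=> /setP/(_ i); rewrite !inE ltnn.
pose rank i := Ordinal (lower_lt i).
have rank_mono i j : (f i < f j)%N -> (rank i < rank j)%N.
  move=> fij; apply: proper_card; apply/properP; split.
    by apply/subsetP=> k; rewrite !inE => fk; exact: ltn_trans fk fij.
  by exists i; rewrite !inE ?ltnn.
have rank_inj : injective rank.
  move=> i j rij; apply: f_inj.
  by have [/rank_mono|/rank_mono|//] := ltngtP (f i) (f j); rewrite rij ltnn.
exists (perm rank_inj)^-1%g => s; apply/idP/eqP => [/increasingP fs | ->].
  apply/permP=> i; apply: (perm_inj (s := perm rank_inj)); rewrite permKV permE.
  apply: val_inj => /=; rewrite -[RHS](card_ord_lt (ltnW (ltn_ord i))).
  rewrite -[RHS](card_imset _ (perm_inj (s := s))); congr #|pred_of_set _|.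
  apply/setP=> j; rewrite -(permKV s j) (mem_imset _ _ (perm_inj (s := s))) !inE.
  exact: fs.
apply/forallP=> i; apply/forallP=> j; apply/implyP; apply: contraTT.
set r := (perm rank_inj)^-1%g; rewrite -!leqNgt => /= le_f.
have rK k : rank (r k) = k by rewrite -[rank _](permE rank_inj) permKV.
rewrite -(rK i) -(rK j); move: le_f; rewrite leq_eqVlt.
by case/predU1P=> [/f_inj ->//|/rank_mono/ltnW].
Qed.

Lemma shuffleE p q (s : 'S_(p + q)) :
  shuffle s = increasing (fun i : 'I_p => s (lshift q i)) &&
              increasing (fun j : 'I_q => s (rshift p j)).
Proof. by []. Qed.

(** Every permutation [r] is [s^-1 * block_perm t u] for exactly one triple with
    [s] a shuffle: [t] and [u] have to sort the restrictions of [r^-1] to the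
    two blocks. *)
Lemma sum_shuffles (M : nmodType) p q (F : 'S_(p + q) -> M) :
  \sum_(t : 'S_p) \sum_(u : 'S_q) \sum_(s : 'S_(p + q) | shuffle s)
     F (s^-1 * block_perm t u)%g = \sum_r F r.
Proof.
under eq_bigr => t _ do under eq_bigr => u _ do
  rewrite (reindex_inj (inj_comp (mulgI (block_perm t u)) invg_inj)) /=.
rewrite pair_bigA /= (exchange_big_dep predT) //=; apply: eq_bigr => r _.
have [t0 t0P] := @sorting_perm p (fun i => r^-1%g (lshift q i))
  (inj_comp (inj_comp val_inj perm_inj) (@lshift_inj _ _)).
have [u0 u0P] := @sorting_perm q (fun i => r^-1%g (rshift p i))
  (inj_comp (inj_comp val_inj perm_inj) (@rshift_inj _ _)).
(* For a given [r] the inner sum runs over the pairs [(t, u)] for which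
   [block_perm t u * r^-1] is a shuffle. *)
rewrite (big_pred1 (t0, u0)) => [|[t u]] /=.
  by rewrite invgM invgK -mulgA mulVg mulg1.
rewrite xpair_eqE -t0P -u0P shuffleE; congr (_ && _);
  apply: eq_forallb => i; apply: eq_forallb => j;
  by rewrite /= !permM ?block_perm_lshift ?block_perm_rshift.
Qed.

(** * Iterated degeneracies of flags *)

(** The quotient map from flags to [SST V] is simplicial, so iterated
    degeneracies can be computed on flags. *)
Lemma sdeg_SST_pr (V : vectType rat) k (f : flag V k) q (b : 'I_q -> nat) :
  sdeg (X := SST V) (SST_pr f) b = SST_pr (sdeg (X := flags V) f b).
Proof.
elim: q b => [//|q IHq] b /=; rewrite IHq.
exact: (@cdegenE _ (bad_flags V)).
Qed.

Lemma cast_SST_pr (V : vectType rat) k l (e : k = l) (f : flag V k) :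
  cast_simp (X := SST V) e (SST_pr f) = SST_pr (cast_simp (X := flags V) e f).
Proof. by case: l / e. Qed.

Lemma cast_flagE (V : vectType rat) k l (e : k = l) (f : flag V k) j :
  flag_fun (cast_simp (X := flags V) e f) j = flag_fun f (inord j).
Proof. by case: l / e j => j; rewrite inord_val. Qed.

Lemma card_ord_recr q (P : pred 'I_q.+1) :
  #|[set i | P i]| =
    (#|[set i : 'I_q | P (widen_ord (leqnSn q) i)]| + P ord_max)%N.
Proof.
rewrite -!sum1dep_card big_mkcond [in RHS]big_mkcond big_ord_recr /=.
by case: (P ord_max).
Qed.

(** Each of the degeneracies repeats one entry, so the entry at [j] comes from
    the position to the left by the number of repetitions made before [j].
    As [b] increases, later degeneracies do not move earlier repetitions. *)
Lemma sdeg_flagE (V : vectType rat) k (f : flag V k) q (b : 'I_q -> nat)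
    (j : 'I_(q + k).+1) :
  increasing b -> (forall i, b i < q + k)%N ->
  flag_fun (sdeg (X := flags V) f b) j =
    flag_fun f (inord (j - #|[set i | (b i < j)%N]|)).
Proof.
elim: q b j => [|q IHq] b j b_incr b_lt.
  rewrite /= (_ : [set i | _] = set0) ?cards0 ?subn0 ?inord_val //.
  by apply/setP=> -[].
have /increasingP b_mono := b_incr.
have b_max : (b ord_max < q + k + 1)%N by rewrite addn1; exact: b_lt.
have b_wid i : (b (widen_ord (leqnSn q) i) < b ord_max)%N.
  by rewrite b_mono /= ltn_ord.
rewrite /= sflagE IHq; first last.
- by move=> i; have := b_wid i; lia.
- by apply/increasingP=> i i'; rewrite b_mono.
congr (flag_fun f (inord _)).
have jlt := ltn_ord j.
have bK : (inord (b ord_max) : 'I_(q + k).+1) = b ord_max :> nat.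
  by rewrite inordK //; exact: b_lt.
rewrite card_ord_recr /unbump bK inordK; last first.
  by move: (b _) (j : nat) jlt b_max => c l; clear; lia.
(* Past the last repetition the outermost degeneracy shifts [j] by one; the
   earlier repetitions all lie strictly before it, so their count below [j] and
   below [j.-1] is the same. *)
case: ltnP => [bj|jb]; last by rewrite subn0 addn0.
rewrite addn1 subn1 subnS predn_sub; congr (_.-1 - _)%N.
apply: eq_card => i; rewrite !inE.
move: (b (widen_ord _ i)) (b ord_max) (j : nat) (b_wid i) bj => c d l; lia.
Qed.

(** * The flag-sum map on shuffled apartments *)

Lemma card_shuffle_lt p q (s : 'S_(p + q)) l : (l <= p + q)%N ->
  (#|[set i : 'I_p | (s (lshift q i) < l)%N]| +
   #|[set j : 'I_q | (s (rshift p j) < l)%N]|)%N = l.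
Proof.
move=> l_le; rewrite -[RHS](card_ord_lt l_le) -!sum1dep_card.
by rewrite [RHS](reindex_inj (@perm_inj _ s)) [RHS]big_mkcond big_split_ord /=
     -!big_mkcond.
Qed.

(** Among the [l] steps before position [l], those at values of [b] are
    repetitions. When [a] and [b] are the two blocks of a shuffle, the remaining
    steps are those at values of [a], and the flag grows there. *)
Lemma sdeg_apt_flagE (V : vectType rat) p (v : p.-tuple V) (t : 'S_p) q
    (a : 'I_p -> nat) (b : 'I_q -> nat) (l : 'I_(q + p).+1) :
  increasing a -> increasing b -> (forall i, b i < q + p)%N ->
  (#|[set i | (a i < l)%N]| + #|[set i | (b i < l)%N]|)%N = l ->
  flag_fun (sdeg (X := flags V) (apt_flag v t) b) l =
    <<[seq tnth v (t i) | i : 'I_p <- enum 'I_p & (a i < l)%N]>>%VS.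
Proof.
move=> a_incr b_incr b_lt ab_card; rewrite sdeg_flagE // apt_flagE.
have -> : (l - #|[set i | (b i < l)%N]|)%N = #|[set i | (a i < l)%N]| by lia.
rewrite inordK; last first.
  by rewrite ltnS -[X in (_ <= X)%N](card_ord p); exact: max_card.
by congr <<map _ _>>%VS; apply: eq_filter => i; rewrite increasing_lt_card.
Qed.

(** In the order [s^-1 * block_perm t u] of the joint basis, the vector [t i] of
    the first block comes at position [s (lshift q i)], which is where the first
    degenerate flag gains it; similarly for the second block. *)
Lemma flag_sum_shuffle p q (v : p.-tuple 'rV[rat]_p) (w : q.-tuple 'rV[rat]_q)
    (t : 'S_p) (u : 'S_q) (s : 'S_(p + q)) :
  shuffle s ->
  flag_sum
    (cast_simp (X := flags 'rV[rat]_p) (addnC q p)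
      (sdeg (X := flags 'rV[rat]_p) (apt_flag v t) (fun j : 'I_q => s (rshift p j))))
    (sdeg (X := flags 'rV[rat]_q) (apt_flag w u) (fun i : 'I_p => s (lshift q i)))
  = apt_flag [tuple of map (@phi p q) v ++ map (@psi p q) w]
      (s^-1 * block_perm t u)%g.
Proof.
rewrite shuffleE => /andP[a_incr b_incr]; apply: flagP => l.
have l_le : (l <= p + q)%N by rewrite -ltnS.
have ab_card := card_shuffle_lt s l_le.
rewrite apt_flagE {1}/flag_fun /= ffunE cast_flagE.
have lK : (inord l : 'I_(q + p).+1) = l :> nat.
  by apply: inordK; rewrite [X in (_ < X.+1)%N]addnC.
rewrite (sdeg_apt_flagE _ _ a_incr) ?lK //; last first.
  by move=> j; rewrite [X in (_ < X)%N]addnC.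
rewrite (sdeg_apt_flagE _ _ b_incr) //; last by rewrite [LHS]addnC.
rewrite !limg_span -span_cat; apply: eq_span => x.
set c := [tuple of _]; set r := (s^-1 * _)%g.
have c_l i : tnth c (lshift q i) = phi q (tnth v i).
  rewrite (tnth_nth 0) /= nth_cat size_map size_tuple ltn_ord.
  by rewrite (nth_map 0) ?size_tuple // -tnth_nth.
have c_r j : tnth c (rshift p j) = psi p (tnth w j).
  rewrite (tnth_nth 0) /= nth_cat size_map size_tuple ltnNge leq_addr /= addKn.
  by rewrite (nth_map 0) ?size_tuple // -tnth_nth.
have r_l i : tnth c (r (s (lshift q i))) = phi q (tnth v (t i)).
  by rewrite /r permM permK block_perm_lshift c_l.
have r_r j : tnth c (r (s (rshift p j))) = psi p (tnth w (u j)).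
  by rewrite /r permM permK block_perm_rshift c_r.
rewrite mem_cat; apply/orP/mapP => [[]|[y]].
- case/mapP=> _ /mapP[i + ->] ->; rewrite mem_filter => /andP[il _].
  exists (s (lshift q i)); first by rewrite mem_filter mem_enum andbT.
  by rewrite lfunE r_l.
- case/mapP=> _ /mapP[j + ->] ->; rewrite mem_filter => /andP[jl _].
  exists (s (rshift p j)); first by rewrite mem_filter mem_enum andbT.
  by rewrite lfunE r_r.
rewrite mem_filter -(permKV s y) => /andP[+ _].
rewrite -(splitK (s^-1%g y)); case: split => [i il|j jl] ->; [left|right].
  rewrite r_l -(lfunE (@phi p q)); apply/map_f/map_f.
  by rewrite mem_filter il mem_enum.
rewrite r_r -(lfunE (@psi p q)); apply/map_f/map_f.
by rewrite mem_filter jl mem_enum.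
Qed.

(** * Evaluating linear extensions on generators *)

Lemma fglift_sum (K : choiceType) (M : lmodType rat) (f : K -> M) (I : finType)
    (c : I -> rat) (x : I -> {freeg K / rat}) :
  fglift f (\sum_i c i *: x i) = \sum_i c i *: fglift f (x i).
Proof.
pose L := GRing.isLinear.Build _ _ _ _ _ (fglift_is_linear f).
pose g : {linear {freeg K / rat} -> M} := HB.pack (fglift f) L.
have gE y : fglift f y = g y by [].
by rewrite gE linear_sum; under eq_bigr => i _ do rewrite linearZ.
Qed.

Lemma fglift_gen (X : psSet) k (x : X k) (M : lmodType rat) (F : X k -> M) :
  nondeg x -> fglift (fun u : ndsimp X k => F (val u)) (gen x) = F x.
Proof. by move=> nx; rewrite /gen insubT liftU scale1r. Qed.

HB.instance Definition _ (X Y : psSet) (f : forall k, X k -> Y k) k :=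
  GRing.isLinear.Build rat (chains X k) (chains Y k) *:%R (@push X Y f k)
    (fglift_is_linear _).

(** A map that commutes with the degeneracies sends degenerate simplices to
    degenerate ones, so the formula for [push] holds on those too. *)
Lemma push_gen (X Y : psSet) (f : forall k, X k -> Y k) k (x : X k) :
  (forall l, f l (bpt X l) = bpt Y l) ->
  (forall l (i : 'I_l.+1) y, f l.+1 (degen i y) = degen i (f l y)) ->
  push f (gen x) = gen (f k x).
Proof.
move=> f_bpt f_degen.
case: (genP x) => [->|x_deg|[u -> _]].
- by rewrite f_bpt !gen_bpt linear0.
- case: k x x_deg => [//|k] x [i [y ->]].
  by rewrite f_degen !gen_degen linear0.
- exact: (fglift_gen (fun z => gen (f k z)) (valP u)).
Qed.

(** [EZ] is the linear extension of [EZ_simp] from the nondegenerate simplices,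
    whence the hypotheses; apartment simplices satisfy them. *)
Lemma EZ_sum_gen (X Y : psSet) p q (I J : finType) (c : I -> rat) (d : J -> rat)
    (x : I -> X p) (y : J -> Y q) :
  (forall i, nondeg (x i)) -> (forall j, nondeg (y j)) ->
  EZ (\sum_i c i *: gen (x i)) (\sum_j d j *: gen (y j)) =
    \sum_i \sum_j (c i * d j) *: EZ_simp (x i) (y j).
Proof.
move=> x_nd y_nd; rewrite /EZ fglift_sum; apply: eq_bigr => i _.
rewrite (fglift_gen (fun z => fglift (fun v => EZ_simp z (val v)) _)) //.
rewrite fglift_sum scaler_sumr; apply: eq_bigr => j _.
by rewrite fglift_gen // scalerA.
Qed.

(** * The flag-sum map is pointed and commutes with degeneracies *)

Section Theta.
Variables m n : nat.

Lemma flag_sumE k (f : flag 'rV[rat]_m k) (g : flag 'rV[rat]_n k) j :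
  flag_fun (flag_sum f g) j =
    (linfun (@phi m n) @: flag_fun f j + linfun (@psi m n) @: flag_fun g j)%VS.
Proof. by rewrite {1}/flag_fun /= ffunE. Qed.

Lemma lker_phi : lker (linfun (@phi m n)) == 0%VS.
Proof.
apply/lker0P=> x y; rewrite !lfunE /= => xy.
by rewrite -[x](row_mxKl x (0 : 'rV_n)) -[y](row_mxKl y (0 : 'rV_n)); congr lsubmx.
Qed.

Lemma lker_psi : lker (linfun (@psi m n)) == 0%VS.
Proof.
apply/lker0P=> x y; rewrite !lfunE /= => xy.
by rewrite -[x](row_mxKr (0 : 'rV_m) x) -[y](row_mxKr (0 : 'rV_m) y); congr rsubmx.
Qed.

Lemma dim_rV d : \dim (fullv : {vspace 'rV[rat]_d}) = d.
Proof. by rewrite dimvf dim_matrix mul1r. Qed.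

(** By injectivity of [phi] and [psi], a sum of subspaces vanishes only if both
    do; by dimension, it is everything only if both are. *)
Lemma bad_flag_sum k (f : flag 'rV[rat]_m k) (g : flag 'rV[rat]_n k) :
  bad_flag f || bad_flag g -> bad_flag (flag_sum f g).
Proof.
apply: contraLR; rewrite !negb_or !negbK !flag_sumE -!subv0 subv_add.
move=> /andP[/andP[f0 g0] fg_full].
have -> : (flag_fun f ord0 <= 0)%VS.
  by rewrite -(eqP lker_phi) lkerE -subv0.
have -> : (flag_fun g ord0 <= 0)%VS.
  by rewrite -(eqP lker_psi) lkerE -subv0.
have : (m + n <= \dim (flag_fun f ord_max) + \dim (flag_fun g ord_max))%N.
  rewrite -(dim_rV (m + n)) -(eqP fg_full).
  rewrite -(limg_dim_eq (f := linfun (@phi m n)) (U := flag_fun f ord_max)); last first.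
    by rewrite (eqP lker_phi) capv0.
  rewrite -(limg_dim_eq (f := linfun (@psi m n)) (U := flag_fun g ord_max)); last first.
    by rewrite (eqP lker_psi) capv0.
  exact: dimv_add_leqif.
have := dimvS (subvf (flag_fun f ord_max)); have := dimvS (subvf (flag_fun g ord_max)).
rewrite /= !eqEdim !subvf !dim_rV /=; lia.
Qed.

(** The smash product only collapses pairs that [theta] sends to the
    basepoint. *)
Lemma theta_smashE k (x : SST 'rV[rat]_m k) (y : SST 'rV[rat]_n k) :
  theta_smash (smash_pair x y) = theta x y.
Proof.
rewrite /smash_pair /cpr; case: insubP => [u _ /= -> //|].
by rewrite negbK => /orP[] /eqP /= ->; case: x.
Qed.

Lemma theta_SST_pr k (f : flag 'rV[rat]_m k) (g : flag 'rV[rat]_n k) :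
  theta (SST_pr f) (SST_pr g) = SST_pr (flag_sum f g).
Proof.
have [bad|] := boolP (bad_flag f || bad_flag g).
  rewrite (bad_SST_pr (bad_flag_sum bad)).
  by case/orP: bad => /bad_SST_pr ->; case: SST_pr.
rewrite negb_or => /andP[f_good g_good].
by rewrite [in LHS]/SST_pr /cpr !insubT.
Qed.

Lemma theta_degen k (i : 'I_k.+1) (x : SST 'rV[rat]_m k) (y : SST 'rV[rat]_n k) :
  theta (degen i x) (degen i y) = degen i (theta x y).
Proof.
have degenE (V : vectType rat) (f : flag V k) :
    degen i (SST_pr f) = SST_pr (sflag i f).
  exact: (@cdegenE _ (bad_flags V)).
have theta_bptr l (z : SST 'rV[rat]_m l) : theta z (bpt (SST 'rV_n) l) = bpt _ l.
  by case: z.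
case: (cprP x) => [->//|[f ->]]; case: (cprP y) => [->|[g ->]].
  exact: etrans (theta_bptr _ _) (congr1 (degen i) (esym (theta_bptr _ _))).
rewrite -/(SST_pr f) -/(SST_pr g) !degenE !theta_SST_pr degenE; congr SST_pr.
by apply: flagP => j; rewrite !(flag_sumE, sflagE).
Qed.

Lemma theta_smash_degen k (i : 'I_k.+1)
    (z : smash (SST 'rV[rat]_m) (SST 'rV[rat]_n) k) :
  theta_smash (degen i z) = degen i (theta_smash z).
Proof.
case: (cprP z) => [->//|[[x y] ->]]; rewrite -/(smash_pair x y).
have -> : degen i (smash_pair x y) = smash_pair (degen i x) (degen i y).
  exact: (@cdegenE _ (wedge _ _)).
by rewrite !theta_smashE theta_degen.
Qed.

End Theta.

(** * Nondegenerate flags and the top degree *)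

Lemma nondeg_SST_pr (V : vectType rat) k (f : flag V k) :
  ~~ bad_flag f -> injective (flag_fun f) -> nondeg (SST_pr f).
Proof.
move=> f_good f_inj; have prE (g : flag V k) : SST_pr f = SST_pr g -> f = g.
  by rewrite /SST_pr /cpr insubT //; case: insubP => // u _ <- [<-].
have f_bpt : SST_pr f != bpt (SST V) k by rewrite /SST_pr /cpr insubT.
rewrite /nondeg f_bpt /=.
apply/negP=> /asboolP.
case: k f f_good f_inj prE f_bpt => [//|k] f _ f_inj prE f_bpt [i [y]].
case: (cprP y) => [->|[g ->]]; first by move=> f0; rewrite f0 in f_bpt.
rewrite [degen i _](@cdegenE _ (bad_flags V)) => /prE fE.
have ii : (i < k.+2)%N by apply: ltnW; rewrite ltnS.
have i1 : (i.+1 < k.+2)%N by rewrite ltnS.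
(* A degeneracy repeats the entry at [i]. *)
suff /f_inj/(congr1 val) /= : flag_fun f (Ordinal ii) = flag_fun f (Ordinal i1).
  exact: n_Sn.
rewrite fE !sflagE; congr (flag_fun g (inord _)); rewrite /= /unbump ltnn ltnS leqnn.
by rewrite subn0 subn1.
Qed.

(** A flag that repeats an entry is degenerate, so in a nondegenerate flag the
    dimension grows at each step. *)
Lemma nondeg_SST_dim (V : vectType rat) k (x : SST V k) :
  nondeg x -> (k <= \dim (fullv : {vspace V}))%N.
Proof.
move=> /andP[+ /asboolP]; case: (cprP x) => [->|[f ->]] {x}; first by rewrite eqxx.
move=> _ f_nd; suff f_dim (j : nat) :
    (j <= k)%N -> (j <= \dim (flag_fun f (inord j)))%N.
  by apply: leq_trans (f_dim k (leqnn k)) (dimvS (subvf _)).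
elim: j => // j IHj jk; apply: leq_ltn_trans (IHj (ltnW jk)) _ => {IHj}.
have f_le : (flag_fun f (inord j) <= flag_fun f (inord j.+1))%VS.
  by apply: flag_le; rewrite !inordK // ltnW.
rewrite ltn_neqAle (dimvS f_le) andbT; apply: contra_notN f_nd => /eqP dim_eq.
have {f_le dim_eq} f_eq : flag_fun f (inord j) = flag_fun f (inord j.+1).
  by apply/eqP; rewrite eqEdim f_le dim_eq /=.
case: k f jk f_eq => [//|k] f jk f_eq.
(* Deleting one of the two equal entries and repeating the other gives [f]. *)
exists (Ordinal jk), (SST_pr (dflag (inord j) f)).
rewrite [RHS](@cdegenE _ (bad_flags V)); congr cpr; apply: flagP => l.
rewrite sflagE dflagE.
have l_lt := ltn_ord l.
have lE : lift (inord j : 'I_k.+2) (inord (unbump j l)) =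
    (if l == j :> nat then j.+1 else l) :> nat.
  rewrite /= /bump /unbump !inordK; try lia.
  case: ltngtP => ? /=; lia.
case: eqVneq lE => [lj|_] lE.
  apply: etrans (etrans _ f_eq) _; congr (flag_fun f _); apply: val_inj.
    by rewrite /= inordK ?lj // ltnW.
  by rewrite [RHS]lE /= inordK.
by congr (flag_fun f _); apply: val_inj; rewrite [RHS]lE.
Qed.

Lemma SST_chains_eq0 (V : vectType rat) k (c : chains (SST V) k) :
  (\dim (fullv : {vspace V}) < k)%N -> c = 0.
Proof.
move=> k_gt; rewrite -[LHS]freeg_sumE big1 // => u _.
by have := nondeg_SST_dim (valP u); rewrite leqNgt k_gt.
Qed.

(** Where there are no boundaries, homology is the space of cycles and the choice
    of a representative is no choice. *)
Lemma hrepr_hclass (X : psSet) k (c : chains X k) :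
  (forall b : chains X k.+1, b = 0) -> bd c = 0 -> hrepr (hclass c) = c.
Proof.
move=> chains0 bd_c; rewrite /hrepr /hclass; set z := insubd _ c.
have zE : val z = c by rewrite /z insubdK //; apply/eqP.
have := lquot_reprK (lquot_pi (@bnd_submod X k) z).
move=> /lquot_piP /asboolP[b]; rewrite (chains0 b) linear0 => /esym/eqP.
by rewrite raddfB subr_eq0 => /eqP ->; exact: zE.
Qed.

(** * Apartments as chains *)

Section BasisFlag.
Variables (V : vectType rat) (n : nat) (v : n.-tuple V).
Hypothesis v_basis : basis_of fullv v.

(** A step of the flag is spanned by part of a basis. *)
Lemma dim_apt_flag (s : 'S_n) l : \dim (flag_fun (apt_flag v s) l) = l.
Proof.
rewrite apt_flagE; set E := [seq _ | _ <- _ & _].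
have E_free : free E.
  apply: (catl_free
    (Y := [seq tnth v (s j) | j : 'I_n <- enum 'I_n & ~~ (j < l)%N])).
  rewrite -map_cat (perm_free (Y := v)) ?(basis_free v_basis) //.
  apply: perm_trans (perm_map _ (permEl (perm_filterC _ _))) _.
  rewrite (map_comp (tnth v) s) -[X in perm_eq _ X]map_tnth_enum perm_map //.
  rewrite uniq_perm ?enum_uniq ?(map_inj_uniq perm_inj) ?enum_uniq // => j.
  by rewrite mem_enum -(permKV s j) map_f ?mem_enum.
rewrite (eqnP E_free) size_map size_filter -sum1_count big_enum_cond /=.
by rewrite sum1dep_card card_ord_lt // -ltnS.
Qed.

Lemma nondeg_apt_flag (s : 'S_n) : nondeg (SST_pr (apt_flag v s)).
Proof.
apply: nondeg_SST_pr => [|i j ij]; last first.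
  by apply: val_inj; rewrite /= -(dim_apt_flag s i) ij dim_apt_flag.
rewrite negb_or !negbK -dimv_eq0 dim_apt_flag eqxx eqEdim subvf dim_apt_flag /=.
by rewrite (size_basis v_basis).
Qed.

Lemma hrepr_apartment : hrepr (apartment v) = apt_chain v.
Proof.
apply: hrepr_hclass => [b|]; last exact: apt_chain_cycle.
by apply: SST_chains_eq0; rewrite (size_basis v_basis).
Qed.

End BasisFlag.

(** * The join product of apartments *)

Theorem proposition3p1 (m n : nat)
    (v : m.-tuple 'rV[rat]_m) (w : n.-tuple 'rV[rat]_n)
    (hv : basis_of fullv v) (hw : basis_of fullv w) :
  mu (apartment v : St m) (apartment w : St n) =
  (apartment [tuple of map (@phi m n) v ++ map (@psi m n) w] : St (m + n)).
Proof.
rewrite /mu !hrepr_apartment //; congr hclass.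
rewrite /apt_chain EZ_sum_gen; try exact: nondeg_apt_flag.
pose G r := gen (SST_pr (apt_flag
  [tuple of map (@phi m n) v ++ map (@psi m n) w] r)) : chains (SST _) _.
rewrite -[RHS](sum_shuffles (fun r : 'S_(m + n) => (-1) ^+ r *: G r)).
rewrite linear_sum; apply: eq_bigr => t _.
rewrite linear_sum; apply: eq_bigr => u _.
rewrite linearZ /= linear_sum scaler_sumr; apply: eq_bigr => s s_shuffle.
rewrite linearZ /= push_gen //; last by move=> l i z; exact: theta_smash_degen.
rewrite theta_smashE !sdeg_SST_pr cast_SST_pr theta_SST_pr flag_sum_shuffle //.
rewrite scalerA; congr (_ *: _).
by rewrite odd_permM odd_permV signr_addb sign_block_perm mulrC.
Qed.
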